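(* Let $p(\cdot)\in\mathcal{P}(\mathbb{R}^d)$ and let $q,\alpha$ be constants with $1\le q\le\alpha\le p(\cdot)$. Then the function norm $\sigma_{p(\cdot),q,\alpha}$ is absolutely continuous, i.e. every element of $\mathcal{H}(p(\cdot),q,\alpha)$ is of absolutely continuous norm.
   Context: $\mathcal{P}(\mathbb{R}^d)$ is the set of measurable $p(\cdot):\mathbb{R}^d\to[1,\infty]$ with $1<p_-\le p(\cdot)\le p_+<\infty$, where $p_-$ and $p_+$ are the essential infimum and supremum. $\|f\|_{p(\cdot)}=\inf\{\lambda>0:\int_{\mathbb{R}^d}(|f(x)|/\lambda)^{p(x)}dx\le1\}$; $L^{p(\cdot)}$ is the set of measurable complex-valued $f$ with $\|f\|_{p(\cdot)}<\infty$; $L^{p(\cdot)}_{\rm loc}$ is the set of measurable $f$ with $f\chi_K\in L^{p(\cdot)}$ for every compact $K$. For $k\in\mathbb{Z}^d$, $r>0$, $I_k^r=\prod_{j=1}^d[rk_j,r(k_j+1))$. $\|f\|_{p(\cdot),q}=\big\|\{\|f\chi_{I_k^1}\|_{p(\cdot)}\}_{k\in\mathbb{Z}^d}\big\|_{\ell^q}$ and $(L^{p(\cdot)},\ell^q)=\{f\in L^{p(\cdot)}_{\rm loc}:\|f\|_{p(\cdot),q}<\infty\}$. For $\rho>0$, $St_\rho^{(\alpha)}f(x)=\rho^{-d/\alpha}f(\rho^{-1}x)$. An $\mathfrak{h}$-decomposition of $f\in L^{p(\cdot)}_{\rm loc}$ is a sequence $\{(c_n,\rho_n,f_n)\}_{n\ge1}$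 in $\mathbb{C}\times(0,\infty)\times(L^{p(\cdot)},\ell^q)$ with $\|f_n\|_{p(\cdot),q}\le1$ for all $n$, $\sum_{n\ge1}|c_n|<\infty$, and $f=\sum_{n\ge1}c_nSt_{\rho_n}^{(\alpha)}f_n$ in the sense of $L^{p(\cdot)}_{\rm loc}$. $\mathcal{H}(p(\cdot),q,\alpha)$ is the set of $f\in L^{p(\cdot)}_{\rm loc}$ having at least one $\mathfrak{h}$-decomposition. $\sigma_{p(\cdot),q,\alpha}(f)$ is the infimum of $\sum_{n\ge1}|c_n|$ over all $\mathfrak{h}$-decompositions of $f$ ($\infty$ if there are none), and the norm of $\mathcal{H}(p(\cdot),q,\alpha)$ is $\|f\|_{\mathcal{H}(p(\cdot),q,\alpha)}=\sigma_{p(\cdot),q,\alpha}(|f|)$. With $X=\mathcal{H}(p(\cdot),q,\alpha)$, an element $f\in X$ is of absolutely continuous norm if $\lim_n\|f_n\|_X=0$ for every sequence $(f_n)_{n\ge1}$ in $X$ with $|f|\ge f_n\ge f_{n+1}$ a.e. for all $n$ and $\lim_nf_n=0$ a.e. *)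

(* Defs.v *)
From HB Require Import structures.
From mathcomp Require Import all_boot all_order all_algebra.
From mathcomp Require Import all_classical all_reals all_analysis.
From mathcomp Require Import measurable_realfun ess_sup_inf complex.

Set Implicit Arguments.
Unset Strict Implicit.
Unset Printing Implicit Defensive.

Import Order.TTheory GRing.Theory Num.Theory.
Import numFieldNormedType.Exports.
Local Open Scope classical_set_scope.
Local Open Scope ring_scope.
Local Open Scope complex_scope.

(* Lebesgue measure on R^d, obtained by Caratheodory's construction from the
   outer measure given by countable covers by half-open boxes. Points of R^d
   are row vectors; the measurable sets are the Lebesgue measurable ones. *)
Section lebesgue_measure_rV.
Context (R : realType) (d : nat).
Local Open Scope ereal_scope.

Definition box (a b : 'rV[R]_d) : set 'rV[R]_d :=
  [set x | forall j, (a 0 j <= x 0 j < b 0 j)%R].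

Definition box_vol (a b : 'rV[R]_d) : R :=
  (\prod_j Num.max 0 (b 0 j - a 0 j))%R.

(* [None] is the empty box, so that covers may be finite or empty (this is
   only needed for d = 0, where every [box a b] is the whole space). *)
Definition obox (B : option ('rV[R]_d * 'rV[R]_d)) : set 'rV[R]_d :=
  if B is Some (a, b) then box a b else set0.

Definition obox_vol (B : option ('rV[R]_d * 'rV[R]_d)) : \bar R :=
  if B is Some (a, b) then (box_vol a b)%:E else 0.

Definition lebesgue_outer (A : set 'rV[R]_d) : \bar R :=
  ereal_inf [set \sum_(k <oo) obox_vol (B k)
            | B in [set B : nat -> option ('rV[R]_d * 'rV[R]_d)
                   | A `<=` \bigcup_k obox (B k)]].

Lemma obox_vol_ge0 B : 0 <= obox_vol B.
Proof.
case: B => [[a b]|] //=; rewrite lee_fin /box_vol.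
by apply: prodr_ge0 => j _; rewrite le_max lexx.
Qed.

Lemma lebesgue_outer_ge0 A : 0 <= lebesgue_outer A.
Proof.
apply: le_ereal_inf_tmp => _ [B _ <-].
by apply: nneseries_ge0 => k *; exact: obox_vol_ge0.
Qed.

Lemma lebesgue_outer0 : lebesgue_outer set0 = 0.
Proof.
apply/eqP; rewrite eq_le lebesgue_outer_ge0 andbT.
apply: ereal_inf_lbound; exists (fun=> None) => //=.
by apply: eseries0.
Qed.

Lemma le_lebesgue_outer : {homo lebesgue_outer : A B / A `<=` B >-> A <= B}.
Proof.
move=> A B AB; apply: ereal_inf_le_tmp => _ [F BF <-].
by exists F => //; exact: subset_trans BF.
Qed.

Lemma lebesgue_outer_sigma_subadditive : sigma_subadditive lebesgue_outer.
Proof.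
move=> A; have [[i ioo]|] := pselect (exists i, lebesgue_outer (A i) = +oo).
  rewrite (eseries_pinfty _ _ ioo) ?leey// => n _.
  by rewrite -ltNye (lt_le_trans _ (lebesgue_outer_ge0 _)).
rewrite -forallNE => Aoo.
suff add2e (e : {posnum R}) : lebesgue_outer (\bigcup_n A n) <=
    \sum_(i <oo) lebesgue_outer (A i) + e%:num%:E.
  by apply/lee_addgt0Pr => _/posnumP[].
rewrite (le_trans _ (epsilon_trick _ _ _))//; last first.
  by move=> n; exact: lebesgue_outer_ge0.
pose P n (B : nat -> option ('rV[R]_d * 'rV[R]_d)) :=
  A n `<=` \bigcup_k obox (B k) /\
  \sum_(k <oo) obox_vol (B k) <=
    lebesgue_outer (A n) + (e%:num / (2 ^ n.+1)%:R)%:E.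
have [G PG] : {G : nat -> nat -> option ('rV[R]_d * 'rV[R]_d)
                 & forall n, P n (G n)}.
  apply: (@choice _ _ P) => n; rewrite /P.
  have en1 : (0 < e%:num / (2 ^ n.+1)%:R)%R by [].
  have fA : lebesgue_outer (A n) \is a fin_num.
    by rewrite ge0_fin_numE ?lebesgue_outer_ge0// ltey; exact/eqP/Aoo.
  have [_ [B AB <-] /ltW BA] := lb_ereal_inf_adherent en1 fA.
  by exists B.
have G0 x : 0 <= (obox_vol \o uncurry G) x by exact: obox_vol_ge0.
apply: (@le_trans _ _ (\esum_(i in setT) (obox_vol \o uncurry G) i)).
  apply: ereal_inf_lbound => /=.
  have /card_esym/ppcard_eqP[f] := card_nat2.
  exists (uncurry G \o f).
    move=> t [i _] /(PG i).1 [j _ Gt].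
    by exists (f^-1%FUN (i, j)) => //=; rewrite invK ?inE.
  rewrite -(esum_pred_image (obox_vol \o uncurry G) _ xpredT) ?[fun=> _]set_true//.
  by rewrite image_eq.
rewrite (_ : esum _ _ = \sum_(i <oo) \sum_(j <oo) obox_vol (G i j)).
  apply: lee_nneseries => [n _ _|n _]; last exact: (PG n).2.
  by apply: nneseries_ge0 => *; exact: obox_vol_ge0.
pose J : nat -> set (nat * nat) := fun i => [set (i, j) | j in setT].
rewrite (_ : setT = \bigcup_k J k); last first.
  by rewrite predeqE => -[a b]; split => // _; exists a => //; exists b.
rewrite esum_bigcupT /=; last 2 first.
- apply/trivIsetP => i j _ _ ij.
  rewrite predeqE => -[n m] /=; split => //= -[] [_] _ [<-{n} _].
  by move=> [m' _] [] /esym/eqP; rewrite (negbTE ij).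
- by move=> *; exact: obox_vol_ge0.
rewrite -(image_id [set: nat]) -fun_true esum_pred_image//; last first.
  by move=> n _; apply: esum_ge0 => *; exact: obox_vol_ge0.
apply: eq_eseriesr => /= j _.
rewrite -(esum_pred_image (obox_vol \o uncurry G) (pair j) predT)//=;
  last 2 first.
- by move=> *; exact: obox_vol_ge0.
- by move=> ? ? _ _; exact: (@can_inj _ _ _ snd).
by congr esum; rewrite predeqE => -[a b]; split; move=> [i _ <-]; exists i.
Qed.

HB.instance Definition _ := isOuterMeasure.Build R 'rV[R]_d lebesgue_outer
  lebesgue_outer0 lebesgue_outer_ge0 le_lebesgue_outer
  lebesgue_outer_sigma_subadditive.

End lebesgue_measure_rV.

(* R^d with the Lebesgue sigma-algebra; convertible to ['rV[R]_d]. *)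
Notation euclidean R d := (caratheodory_type (@lebesgue_outer R d)).

Definition lebesgue (R : realType) (d : nat) :
  set (euclidean R d) -> \bar R := @lebesgue_outer R d.

HB.instance Definition _ (R : realType) (d : nat) :=
  isMeasure.Build _ (euclidean R d) R (@lebesgue R d)
    (@caratheodory_measure0 _ _ (@lebesgue_outer R d))
    (@caratheodory_measure_ge0 _ _ (@lebesgue_outer R d))
    (@caratheodory_measure_sigma_additive _ _ (@lebesgue_outer R d)).

Section function_spaces.
Context (R : realType) (d : nat).
Local Notation V := 'rV[R]_d.
Local Notation C := R[i].
Local Notation modulus := Normc.normc.
Local Notation mu := (@lebesgue R d).

Implicit Types (p : V -> \bar R) (f : V -> C) (q alpha : R).

Definition cmeasurable f : Prop :=
  measurable_fun [set: euclidean R d] (fun x => complex.Re (f x) : R) /\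
  measurable_fun [set: euclidean R d] (fun x => complex.Im (f x) : R).

Definition variable_exponent p : Prop :=
  [/\ measurable_fun [set: euclidean R d] (p : euclidean R d -> \bar R),
      forall x, (1 <= p x)%E,
      (1 < ess_inf mu p)%E &
      (ess_sup mu p < +oo)%E].

(* t ^ r for t >= 0 and r in [1, +oo], with t ^ oo = 0 if t <= 1 and
   t ^ oo = oo if t > 1. *)
Definition expo (t : R) (r : \bar R) : \bar R :=
  match r with
  | r%:E => (t `^ r)%:E
  | _ => if t <= 1 then 0%E else +oo%E
  end.

Definition vnorm p f : \bar R :=
  ereal_inf [set l%:E | l in [set l : R | 0 < l /\
    (\int[mu]_x expo (modulus (f x) / l)%R (p x) <= 1)%E]].

Definition Lvar p f : Prop := cmeasurable f /\ (vnorm p f < +oo)%E.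

Definition cutoff (A : set V) f : V -> C := patch (fun=> 0) A f.

Definition Lvar_loc p f : Prop :=
  cmeasurable f /\ forall K : set V, compact K -> Lvar p (cutoff K f).

Definition cube (r : R) (k : 'rV[int]_d) : set V :=
  [set x | forall j, r * (k 0 j)%:~R <= x 0 j < r * ((k 0 j)%:~R + 1)].

Definition amalgam_norm p q f : \bar R :=
  ((\esum_(k in [set: 'rV[int]_d]) (vnorm p (cutoff (cube 1 k) f) `^ q)) `^ q^-1)%E.

Definition amalgam p q f : Prop :=
  Lvar_loc p f /\ (amalgam_norm p q f < +oo)%E.

Definition dil alpha (rho : R) f : V -> C :=
  fun x => (rho `^ (- (d%:R / alpha)))%:C * f (rho^-1 *: x).

(* Convergence in the space [Lvar_loc p]: the terms belong to the space. *)
Definition cvg_loc p (u : nat -> V -> C) f : Prop :=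
  [/\ forall n, Lvar_loc p (u n),
      Lvar_loc p f &
      forall K : set V, compact K ->
        vnorm p (cutoff K (fun x => u n x - f x)) @[n --> \oo] --> 0%E].

Definition coef_sum (c : nat -> C) : \bar R :=
  (\sum_(n <oo) (modulus (c n))%:E)%E.

Definition h_decomposition p q alpha f
    (c : nat -> C) (rho : nat -> R) (g : nat -> V -> C) : Prop :=
  [/\ forall n, 0 < rho n,
      forall n, amalgam p q (g n) /\ (amalgam_norm p q (g n) <= 1)%E,
      (coef_sum c < +oo)%E &
      cvg_loc p
        (fun N x => \sum_(n < N) c n * dil alpha (rho n) (g n) x) f].

Definition Hspace p q alpha f : Prop :=
  Lvar_loc p f /\ exists c rho g, h_decomposition p q alpha f c rho g.

Definition sigma p q alpha f : \bar R :=
  ereal_inf [set s | exists c rho g,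
    h_decomposition p q alpha f c rho g /\ s = coef_sum c].

Definition Hnorm p q alpha f : \bar R := sigma p q alpha (fun x => `|f x|).

(* [<=] is the order of R[i]: z <= w iff w - z is a nonnegative real. In
   particular the [u n] below are a.e. real valued. *)
Definition Habs_continuous_norm p q alpha f : Prop :=
  forall u : nat -> V -> C,
    (forall n, Hspace p q alpha (u n)) ->
    (forall n, \forall x \ae mu, u n x <= `|f x| /\ u n.+1 x <= u n x) ->
    (\forall x \ae mu, modulus (u n x) @[n --> \oo] --> (0 : R)) ->
    Hnorm p q alpha (u n) @[n --> \oo] --> 0%E.

End function_spaces.

(* Main.v *)
Require Import Defs.
From mathcomp Require Import all_boot all_order all_algebra.
From mathcomp Require Import all_classical all_reals all_analysis.
From mathcomp Require Import measurable_realfun ess_sup_inf complex.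
From mathcomp Require Import lra ring.
Import Order.TTheory GRing.Theory Num.Theory.
Import numFieldNormedType.Exports.
Local Open Scope classical_set_scope.
Local Open Scope ring_scope.

(** The functions [u n] are dominated by [|f|] and decrease to 0 almost
everywhere, so they are nonnegative reals there
([modulus_decreasing_le]), and [|u n| = m n * f] almost everywhere for
multipliers [m n] with modulus at most 1 everywhere and tending to 0 almost
everywhere ([phase_quotient]).

Bounded multipliers act on decompositions. If [f] is the sum of the
[c k * dil (rho k) (g k)], then, dilation being a change of variable, [m * f] is
the sum of the [c k * dil (rho k) (m (rho k * _) * g k)], and the multiplied
partial sums converge because the variable Lebesgue norm is monotone in the
modulus ([h_decomposition_multiplier]). So one fixed decomposition of [f] yields
decompositions of all the [|u n|], and it remains to see that their
coefficients can be made small.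

For this, the amalgam norm of [m n * g] tends to 0 for every [g] in the amalgam
space ([amalgam_multiplier_cvg0]). On each unit cube this is dominated
convergence for the modular, where the essential boundedness of the exponent
makes the modular finite at every scale ([vnorm_multiplier_cvg0]); the [l^q] sum
over the cubes follows by Tannery's theorem ([esum_eventually_small]). Hence,
for any small [s > 0] and any [N], the first [N] coefficients may be multiplied
by [s] and the corresponding atoms by [1 / s]: for large [n] the atoms still
have norm at most 1. The remaining coefficients form the tail of a convergent
series ([sigma_multiplier_cvg0]).

Dilated multipliers have to be measurable and to converge almost everywhere, and
cut-offs to cubes have to be measurable; both come from the way the outer
measure built on boxes behaves under dilations and when cut along coordinate
hyperplanes. *)

(** * Lebesgue measure: dilations, cubes and null sets *)

Section lebesgue_rV.
Set Implicit Arguments.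
Unset Strict Implicit.
Context {R : realType} {d : nat}.
Implicit Types (A X : set 'rV[R]_d) (r : R).
Local Open Scope ereal_scope.

(** Dilating the boxes of a cover of [A] gives a cover of its preimage. *)
Lemma lebesgue_outer_preimage_scale_le r A : (0 < r)%R ->
  lebesgue_outer ((fun x => r *: x) @^-1` A)
    <= ((r^-1 ^+ d)%:E * lebesgue_outer A).
Proof.
move=> r0; rewrite muleC -lee_pdivrMr ?exprn_gt0 ?invr_gt0//.
apply: le_ereal_inf_tmp => _ [B AB <-].
rewrite lee_pdivrMr ?exprn_gt0 ?invr_gt0// muleC -nneseriesZl; last first.
  by move=> *; exact: obox_vol_ge0.
apply: ereal_inf_lbound.
exists (fun k => omap (fun ab => (r^-1 *: ab.1, r^-1 *: ab.2)) (B k)).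
  move=> x /AB [k _ Bx]; exists k => //.
  case: (B k) Bx => [[a b]|]//= Bx j.
  by move: (Bx j); rewrite !mxE ler_pdivrMl// ltr_pdivlMl.
apply: eq_eseriesr => k _; case: (B k) => [[a b]|] /=; last by rewrite mule0.
rewrite -EFinM; congr EFin; rewrite /box_vol.
have -> : (r^-1 ^+ d = \prod_(j < d) r^-1)%R by rewrite prodr_const card_ord.
rewrite -big_split/=; apply: eq_bigr => j _.
by rewrite !mxE -mulrBr maxr_pMr ?invr_ge0 ?(ltW r0)// mulr0.
Qed.

(** Dilating back by the inverse ratio turns the bound into an equality. *)
Lemma lebesgue_outer_preimage_scale r A : (0 < r)%R ->
  lebesgue_outer ((fun x => r *: x) @^-1` A)
    = ((r^-1 ^+ d)%:E * lebesgue_outer A).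
Proof.
move=> r0; apply/eqP; rewrite eq_le lebesgue_outer_preimage_scale_le//=.
rewrite muleC -lee_pdivlMr ?exprn_gt0 ?invr_gt0//.
have ri0 : (0 < r^-1)%R by rewrite invr_gt0.
have := lebesgue_outer_preimage_scale_le ((fun x => r *: x) @^-1` A) ri0.
rewrite muleC invrK -exprVn invrK; congr (_ <= _); congr lebesgue_outer.
by apply/seteqP; split => x /=; rewrite scalerA divff ?gt_eqF// scale1r.
Qed.

(** A dilation multiplies the outer measure of every set by the same factor, so
it preserves the Caratheodory splitting condition. *)
Lemma measurable_scale r : (0 < r)%R ->
  measurable_fun [set: euclidean R d]
    ((fun x => r *: x) : euclidean R d -> euclidean R d).
Proof.
move=> r0 _ A mA; rewrite setTI.
have {}mA : caratheodory_measurable (@lebesgue_outer R d) A := mA.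
suff : caratheodory_measurable (@lebesgue_outer R d)
  ((fun x : 'rV[R]_d => r *: x) @^-1` A) by [].
move=> X.
have ri0 : (0 < r^-1)%R by rewrite invr_gt0.
pose Y : set 'rV[R]_d := (fun x => r^-1 *: x) @^-1` X.
have XE Z : (fun x : 'rV[R]_d => r *: x) @^-1` (Y `&` Z) =
            X `&` (fun x => r *: x) @^-1` Z.
  apply/seteqP; split => x /=;
  by rewrite /Y/= scalerA mulVf ?gt_eqF// scale1r.
have XT : X = (fun x : 'rV[R]_d => r *: x) @^-1` Y.
  by have := XE setT; rewrite setIT preimage_setT setIT => <-.
have -> : ~` ((fun x : 'rV[R]_d => r *: x) @^-1` A)
  = (fun x => r *: x) @^-1` (~` A) by [].
rewrite -!XE {1}XT !(lebesgue_outer_preimage_scale (Y `&` _) r0).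
rewrite (lebesgue_outer_preimage_scale Y r0) (mA Y).
by rewrite muleDr// ge0_adde_def// inE lebesgue_outer_ge0.
Qed.

Lemma ae_imply (P Q : 'rV[R]_d -> Prop) : (forall x, P x -> Q x) ->
  (\forall x \ae (@lebesgue R d), P x) -> \forall x \ae (@lebesgue R d), Q x.
Proof.
move=> PQ [N [mN N0 NP]]; exists N; split => // x /= nQ.
by apply: NP => /= /PQ.
Qed.

Lemma ae_and (P Q : 'rV[R]_d -> Prop) :
  (\forall x \ae (@lebesgue R d), P x) ->
  (\forall x \ae (@lebesgue R d), Q x) ->
  \forall x \ae (@lebesgue R d), P x /\ Q x.
Proof.
pose M : {measure set (euclidean R d) -> \bar R} := @lebesgue R d.
exact: (@filterI _ _ (ae_filter_ringOfSetsType M)).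
Qed.

Lemma ae_forall (P : nat -> 'rV[R]_d -> Prop) :
  (forall n, \forall x \ae (@lebesgue R d), P n x) ->
  \forall x \ae (@lebesgue R d), forall n, P n x.
Proof.
pose M : {measure set (euclidean R d) -> \bar R} := @lebesgue R d.
move=> Pae; exact: (@ae_foralln _ _ _ M).
Qed.

Lemma le_integral_lebesgue (F G : 'rV[R]_d -> \bar R) :
  measurable_fun [set: euclidean R d] F ->
  measurable_fun [set: euclidean R d] G ->
  (forall x, 0 <= F x) -> (forall x, 0 <= G x) ->
  (\forall x \ae (@lebesgue R d), F x <= G x) ->
  \int[@lebesgue R d]_x F x <= \int[@lebesgue R d]_x G x.
Proof.
pose M : {measure set (euclidean R d) -> \bar R} := @lebesgue R d.
move=> mF mG F0 G0 FG.
apply: (@ae_ge0_le_integral _ (euclidean R d) R M setT measurableT F G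
  (fun x _ => F0 x) mF (fun x _ => G0 x) mG).
by apply: ae_imply FG.
Qed.

Lemma ae_scale r (P : 'rV[R]_d -> Prop) : (0 < r)%R ->
  (\forall x \ae (@lebesgue R d), P x) ->
  \forall x \ae (@lebesgue R d), P (r *: x).
Proof.
move=> r0 [N [mN N0 PN]].
exists ((fun x => r *: x) @^-1` N); split.
- by have := measurable_scale r0; move=> /(_ measurableT N mN); rewrite setTI.
- rewrite /lebesgue lebesgue_outer_preimage_scale//.
  by rewrite (_ : lebesgue_outer N = 0)// mule0.
- by move=> x /= Px; apply: PN.
Qed.

Lemma length_split (a b c : R) :
  (Num.max 0 (b - a) = Num.max 0 (Num.min b c - a) + Num.max 0 (b - Num.max a c))%R.
Proof.
have [bc|/ltW cb] := leP b c; have [ac|/ltW ca] := leP a c.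
- by rewrite (@max_l _ _ 0%R (b - c)%R) ?addr0// subr_le0.
- by rewrite (@max_l _ _ 0%R (b - a)%R) ?addr0// subr_le0 (le_trans bc).
- by rewrite !max_r ?subr_ge0// ?(le_trans ac cb)// [RHS]addrC subrKA.
- by rewrite (@max_l _ _ 0%R (c - a)%R) ?add0r// subr_le0.
Qed.

(** A hyperplane orthogonal to an axis cuts every box into two boxes whose
volumes add up, so it splits every cover into covers of the two parts of a test
set. *)
Lemma measurable_halfspace (j : 'I_d) (c : R) :
  measurable ([set x | (x 0 j < c)%R] : set (euclidean R d)).
Proof.
apply: le_caratheodory_measurable => X.
apply: le_ereal_inf_tmp => _ [B XB <-].
pose low (v : 'rV[R]_d) := \row_i (if i == j then Num.min (v 0 i) c else v 0 i)%R.
pose up (v : 'rV[R]_d) := \row_i (if i == j then Num.max (v 0 i) c else v 0 i)%R.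
pose B1 k := omap (fun ab : 'rV[R]_d * 'rV[R]_d => (ab.1, low ab.2)) (B k).
pose B2 k := omap (fun ab : 'rV[R]_d * 'rV[R]_d => (up ab.1, ab.2)) (B k).
have volE k : obox_vol (B k) = obox_vol (B1 k) + obox_vol (B2 k).
  rewrite /B1 /B2; case: (B k) => [[a b]|] /=; last by rewrite adde0.
  rewrite -EFinD; congr EFin; rewrite /box_vol.
  have prodE (F : 'I_d -> R) : (\prod_i F i = F j * \prod_(i < d | i != j) F i)%R.
    by rewrite (bigD1 j).
  rewrite !prodE !mxE eqxx.
  set P := (\prod_(i < d | i != j) Num.max 0 (b 0 i - a 0 i))%R.
  have -> : (\prod_(i < d | i != j) Num.max 0 (low b 0 i - a 0 i) = P)%R.
    by apply: eq_bigr => i /negPf ij; rewrite !mxE ij.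
  have -> : (\prod_(i < d | i != j) Num.max 0 (b 0 i - up a 0 i) = P)%R.
    by apply: eq_bigr => i /negPf ij; rewrite !mxE ij.
  rewrite -mulrDl; congr (_ * _)%R; exact: length_split.
rewrite (eq_eseriesr (fun k _ => volE k)) nneseriesD//; last 2 first.
- by move=> *; exact: obox_vol_ge0.
- by move=> *; exact: obox_vol_ge0.
apply: leeD; apply: ereal_inf_lbound.
- exists B1 => // x [/XB [k _ Bx] /= xc]; exists k => //; rewrite /B1.
  case: (B k) Bx => [[a b]|]//= Bx i; move: (Bx i) => /andP[-> xb] /=.
  by rewrite mxE; case: eqP => [ij|//]; rewrite lt_min xb ij.
- exists B2 => // x [/XB [k _ Bx] /= /negP xc]; exists k => //; rewrite /B2.
  case: (B k) Bx => [[a b]|]//= Bx i; move: (Bx i) => /andP[xb ->] /=.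
  rewrite andbT mxE; case: eqP => [ij|//]; rewrite ge_max xb ij/=.
  by rewrite leNgt.
Qed.

Lemma measurable_cube (r : R) (k : 'rV[int]_d) :
  measurable (cube r k : set (euclidean R d)).
Proof.
have -> : cube r k = \bigcap_(j in [set: 'I_d])
    ((~` [set x : 'rV[R]_d | x 0 j < r * (k 0 j)%:~R]%R) `&`
      [set x : 'rV[R]_d | x 0 j < r * ((k 0 j)%:~R + 1)]%R).
  apply/seteqP; split => x /= xk.
  - move=> j _ /=; have /andP[h ->] := xk j; split => //.
    by apply/negP; rewrite -leNgt.
  - by move=> j; have [/negP] := xk j I; rewrite -leNgt => -> ->.
apply: fin_bigcap_measurable => // j _; apply: measurableI.
  by apply: measurableC; exact: measurable_halfspace.
exact: measurable_halfspace.
Qed.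

End lebesgue_rV.

(** * Measurability of complex functions *)

Section complex_measurability.
Set Implicit Arguments.
Unset Strict Implicit.
Local Open Scope complex_scope.
Context {R : realType} {d : nat}.
Local Notation V := 'rV[R]_d.
Local Notation modulus := Normc.normc.
Implicit Types f g : V -> R[i].

Lemma modulus_ge0 (z : R[i]) : 0 <= modulus z.
Proof. by case: z => a b; rewrite sqrtr_ge0. Qed.

Lemma normc_modulus (z : R[i]) : `|z| = (modulus z)%:C.
Proof. by rewrite normc_def; case: z. Qed.

Lemma modulus_real (t : R) : modulus t%:C = `|t|.
Proof. by rewrite /= expr0n/= addr0 sqrtr_sqr. Qed.

Lemma measurable_modulus f : cmeasurable f ->
  measurable_fun [set: euclidean R d] (fun x => modulus (f x) : R).
Proof.
move=> [mr mi].
rewrite (_ : (fun x => _) = (fun x => (complex.Re (f x) ^+ 2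
   + complex.Im (f x) ^+ 2) `^ 2^-1)); last first.
  apply/funext => x; rewrite powR12_sqrt ?addr_ge0 ?sqr_ge0//.
  by case: (f x).
apply: (measurableT_comp (@measurable_powR R 2^-1)).
by apply: measurable_funD; exact: measurable_funX.
Qed.

Lemma cmeasurableM f g : cmeasurable f -> cmeasurable g ->
  cmeasurable (fun x => f x * g x).
Proof.
move=> [fr fi] [gr gi]; split.
- rewrite (_ : (fun x => _) = (fun x => complex.Re (f x) * complex.Re (g x)
      - complex.Im (f x) * complex.Im (g x))); last first.
    by apply/funext => x; case: (f x); case: (g x).
  by apply: measurable_funB; exact: measurable_funM.
- rewrite (_ : (fun x => _) = (fun x => complex.Re (f x) * complex.Im (g x)
      + complex.Im (f x) * complex.Re (g x))); last first.
    by apply/funext => x; case: (f x); case: (g x).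
  by apply: measurable_funD; exact: measurable_funM.
Qed.

Lemma cmeasurableB f g : cmeasurable f -> cmeasurable g ->
  cmeasurable (fun x => f x - g x).
Proof.
move=> [fr fi] [gr gi]; split.
- rewrite (_ : (fun x => _) = (fun x => complex.Re (f x) - complex.Re (g x))).
    exact: measurable_funB.
  by apply/funext => x; case: (f x); case: (g x).
- rewrite (_ : (fun x => _) = (fun x => complex.Im (f x) - complex.Im (g x))).
    exact: measurable_funB.
  by apply/funext => x; case: (f x); case: (g x).
Qed.

Lemma cmeasurable_real (t : V -> R) : measurable_fun [set: euclidean R d] t ->
  cmeasurable (fun x => (t x)%:C).
Proof. by move=> mt; split => //; exact: measurable_cst. Qed.

Lemma cmeasurableV f : cmeasurable f -> cmeasurable (fun x => (f x)^-1).
Proof.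
move=> mf; have [fr fi] := mf.
have mn : measurable_fun [set: euclidean R d]
    (fun x => (modulus (f x) `^ (- 2%:R) : R)).
  by apply: (measurableT_comp (measurable_powR _)); exact: measurable_modulus.
have nE x : modulus (f x) `^ (- 2%:R) =
    (complex.Re (f x) ^+ 2 + complex.Im (f x) ^+ 2)^-1.
  rewrite powR_invn ?modulus_ge0//.
  by case: (f x) => a b /=; rewrite sqr_sqrtr// addr_ge0 ?sqr_ge0.
split.
- rewrite (_ : (fun x => _) =
      (fun x => complex.Re (f x) * modulus (f x) `^ (- 2%:R))).
    exact: measurable_funM.
  by apply/funext => x; rewrite nE; case: (f x).
- rewrite (_ : (fun x => _) =
      (fun x => - (complex.Im (f x) * modulus (f x) `^ (- 2%:R)))).
    by apply: measurable_funN; exact: measurable_funM.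
  by apply/funext => x; rewrite nE; case: (f x) => a b /=.
Qed.

Lemma cmeasurable_scale (r : R) f : 0 < r -> cmeasurable f ->
  cmeasurable (fun x => f (r *: x)).
Proof.
move=> r0 [fr fi]; split.
- exact: (measurableT_comp fr (measurable_scale r0)).
- exact: (measurableT_comp fi (measurable_scale r0)).
Qed.

Lemma cmeasurable_cutoff (A : set V) f :
  measurable (A : set (euclidean R d)) ->
  cmeasurable f -> cmeasurable (cutoff A f).
Proof.
move=> mA mf.
rewrite (_ : cutoff A f = (fun x => ((\1_A x : R))%:C * f x)).
  have m1 : cmeasurable (fun x : V => ((\1_A x : R))%:C).
    by apply: cmeasurable_real; exact: measurable_indic.
  exact: (cmeasurableM m1 mf).
apply/funext => x; rewrite /cutoff /patch indicE.
by case: (x \in A); rewrite /= ?rmorph1 ?rmorph0 ?mul1r ?mul0r.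
Qed.

End complex_measurability.

(** * The variable Lebesgue norm *)

Section variable_lebesgue.
Set Implicit Arguments.
Unset Strict Implicit.
Local Open Scope complex_scope.
Context {R : realType} {d : nat}.
Local Notation V := 'rV[R]_d.
Local Notation modulus := Normc.normc.
Local Notation mu := (@lebesgue R d).
Implicit Types (f g : V -> R[i]) (p : V -> \bar R).

Lemma expo_ge0 (t : R) (r : \bar R) : (0 <= expo t r)%E.
Proof.
by case: r => [r| |] /=; [rewrite lee_fin powR_ge0| case: ifP..].
Qed.

Lemma le_expo (s t : R) (r : \bar R) : 0 <= s -> s <= t -> (1 <= r)%E ->
  (expo s r <= expo t r)%E.
Proof.
move=> s0 st; have t0 := le_trans s0 st.
case: r => [r| |]//=.
  rewrite !lee_fin => r1; apply: ge0_ler_powR; rewrite ?nnegrE//.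
  exact: le_trans r1.
by move=> _; case: (leP s 1) => s1; case: (leP t 1) => t1//;
  rewrite ?leey//; move: (lt_le_trans s1 st); rewrite ltNge t1.
Qed.

(** Convexity of [t |-> t ^ r], which vanishes at 0. This linear bound makes the
multiplier a plain factor in the modular. *)
Lemma expo_contract (c t : R) (r : \bar R) : 0 <= c <= 1 -> 0 <= t ->
  (1 <= r)%E -> (expo (c * t) r <= c%:E * expo t r)%E.
Proof.
move=> /andP[]; rewrite le_eqVlt => /predU1P[<- _|c0 c1] t0.
  rewrite mul0r mul0e; case: r => [r| |]//=; last by rewrite ler01.
  by rewrite !lee_fin => r1; rewrite powR0// gt_eqF// (lt_le_trans _ r1).
case: r => [r| |]//=.
  rewrite -EFinM !lee_fin => r1; apply: ge1r_powRZ => //.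
  by rewrite c0 c1.
move=> _; have [t1|t1] := leP t 1; last by rewrite gt0_muley ?leey ?lte_fin.
by rewrite mule0 (le_trans _ t1)// ler_piMl.
Qed.

Lemma expo_dilate (c t s : R) (r : \bar R) : 1 <= c -> 0 <= t ->
  (1 <= r)%E -> (r <= s%:E)%E -> (expo (c * t) r <= (c `^ s)%:E * expo t r)%E.
Proof.
move=> c1 t0; case: r => [r| |]//=.
rewrite -EFinM !lee_fin => r1 rs.
have c0 : 0 <= c by apply: le_trans c1.
by rewrite powRM// ler_wpM2r ?powR_ge0//; apply: ler_powR.
Qed.

(** Written with [expR] and [ln], the power is jointly measurable in base and
exponent; an infinite exponent and a zero base are split off first. *)
Lemma measurable_expo (h : V -> R) p : variable_exponent p ->
  (forall x, 0 <= h x) -> measurable_fun [set: euclidean R d] h ->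
  measurable_fun [set: euclidean R d] (fun x => expo (h x) (p x)).
Proof.
move=> [mp p1 _ _] h0 mh.
rewrite (_ : (fun x => _) = fun x => if p x == +oo%E then
    (if h x <= 1 then 0%E else +oo%E) else
    (if h x <= 0 then 0%E else (expR (fine (p x) * ln (h x)))%:E)); last first.
  apply/funext => x; move: (p1 x); case: (p x) => [r| |]//=.
  rewrite lee_fin => r1.
  have [h1|h1] := leP (h x) 0.
    have -> : h x = 0 by apply/eqP; rewrite eq_le h1 h0.
    by rewrite powR0// gt_eqF// (lt_le_trans _ r1).
  by rewrite /powR gt_eqF.
apply: measurable_fun_ifT.
- by apply: measurable_fun_eqe => //; exact: measurable_cst.
- apply: measurable_fun_ifT; last 2 first.
  + exact: measurable_cst.
  + exact: measurable_cst.
  + by apply: measurable_fun_ler => //; exact: measurable_cst.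
- apply: measurable_fun_ifT.
  + by apply: measurable_fun_ler => //; exact: measurable_cst.
  + exact: measurable_cst.
  + apply/measurable_EFinP; apply: (measurableT_comp (@measurable_expR R)).
    apply: measurable_funM.
      by apply: (measurableT_comp (fine_measurable measurableT)).
    exact: (measurableT_comp (@measurable_ln R)).
Qed.

Lemma measurable_modular f p (l : R) : variable_exponent p -> 0 < l ->
  cmeasurable f -> measurable_fun [set: euclidean R d]
    (fun x => expo (modulus (f x) / l) (p x)).
Proof.
move=> hp l0 mf.
have h0 x : 0 <= modulus (f x) / l by rewrite divr_ge0 ?modulus_ge0 ?ltW.
apply: (@measurable_expo (fun x => modulus (f x) / l) p hp h0).
by apply: measurable_funM; [exact: measurable_modulus|exact: measurable_cst].
Qed.

Lemma vnorm_ge0 p f : (0 <= vnorm p f)%E.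
Proof.
by apply: le_ereal_inf_tmp => _ [l [l0 _] <-]; rewrite lee_fin ltW.
Qed.

Lemma vnorm_le p f (l : R) : 0 < l ->
  (\int[mu]_x expo (modulus (f x) / l)%R (p x) <= 1)%E ->
  (vnorm p f <= l%:E)%E.
Proof. by move=> l0 fl; apply: ereal_inf_lbound; exists l. Qed.

Lemma le_vnorm p f g : variable_exponent p -> cmeasurable f -> cmeasurable g ->
  (\forall x \ae mu, modulus (f x) <= modulus (g x)) ->
  (vnorm p f <= vnorm p g)%E.
Proof.
move=> hp mf mg fg; apply: ereal_inf_le_tmp => _ [l [l0 gl] <-].
exists l => //; split => //; apply: le_trans gl.
apply: le_integral_lebesgue.
- exact: measurable_modular.
- exact: measurable_modular.
- by move=> x; exact: expo_ge0.
- by move=> x; exact: expo_ge0.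
apply: ae_imply fg => x fgx; apply: le_expo.
- by rewrite divr_ge0 ?modulus_ge0 ?ltW.
- by rewrite ler_pM2r ?invr_gt0.
- by case: hp.
Qed.

Lemma vnormZ_le p f (c : R[i]) : c != 0 ->
  (vnorm p (fun x => c * f x)%R <= (modulus c)%:E * vnorm p f)%E.
Proof.
move=> c0; have m0 : 0 < modulus c.
  rewrite lt_def modulus_ge0 andbT; apply: contra c0 => /eqP.
  by move=> /Normc.eq0_normc ->.
rewrite muleC -lee_pdivrMr//; apply: le_ereal_inf_tmp => _ [l [l0 fl] <-].
rewrite lee_pdivrMr// muleC; apply: vnorm_le; first exact: mulr_gt0.
apply: le_trans fl; rewrite le_eqVlt; apply/orP; left; apply/eqP.
apply: eq_integral => x _; congr expo.
by rewrite Normc.normcM -mulf_div divff ?gt_eqF// mul1r.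
Qed.

(** The norm bounds the modular at one scale only; an essentially bounded
exponent allows changing the scale at the cost of a constant factor. *)
Lemma vnorm_finite_modular p f : variable_exponent p -> cmeasurable f ->
  (vnorm p f < +oo)%E -> forall l : R, 0 < l ->
  (\int[mu]_x expo (modulus (f x) / l)%R (p x) < +oo)%E.
Proof.
move=> hp mf /ereal_inf_lt [_ [L [L0 fL] <-] _] l l0.
have [mp p1 _ psup] := hp.
have /ereal_inf_lt [s' /= ps' s'oo] := psup.
have [s ps] : exists s : R, \forall x \ae mu, (p x <= s%:E)%E.
  case: s' ps' s'oo => [s ps _|_|ps _]; [by exists s|by rewrite ltxx|].
  by exists 0; apply: ae_imply ps => x; move=> /le_trans; apply; exact: leNye.
pose c := Num.max 1 (L / l).
have c1 : 1 <= c by rewrite le_max lexx.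
apply: (@le_lt_trans _ _ ((c `^ s)%:E *
    \int[mu]_x expo (modulus (f x) / L) (p x))%E); last first.
  rewrite lte_mul_pinfty ?lee_fin ?powR_ge0//.
  exact: le_lt_trans fL (ltey _).
pose M : {measure set (euclidean R d) -> \bar R} := mu.
have cs0 : (0 <= (c `^ s)%:E)%E by rewrite lee_fin powR_ge0.
rewrite -(@ge0_integralZl _ (euclidean R d) R M setT measurableT _
  (measurable_modular hp L0 mf) _ (fun x _ => expo_ge0 _ _) cs0).
apply: le_integral_lebesgue.
- exact: measurable_modular.
- by apply: measurable_funeM; exact: measurable_modular.
- by move=> x; exact: expo_ge0.
- by move=> x; rewrite mule_ge0 ?expo_ge0 ?lee_fin ?powR_ge0.
apply: ae_imply ps => x px; apply: (@le_trans _ _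
    (expo (c * (modulus (f x) / L)) (p x))).
  apply: le_expo => //.
    by rewrite divr_ge0 ?modulus_ge0 ?ltW.
  rewrite mulrCA ler_wpM2l ?modulus_ge0// -ler_pdivrMr ?invr_gt0//.
  by rewrite invrK mulrC le_max lexx orbT.
apply: expo_dilate => //.
by rewrite divr_ge0 ?modulus_ge0 ?ltW.
Qed.

(** Absolute continuity of the variable Lebesgue norm. By convexity the modular
of [m n * f] at scale [l] is at most the integral of [|m n|] against the
modular density of [f], and that density is integrable at every scale because
the exponent is essentially bounded; so dominated convergence applies. *)
Lemma vnorm_multiplier_cvg0 p f (m : nat -> V -> R[i]) : variable_exponent p ->
  cmeasurable f -> (vnorm p f < +oo)%E ->
  (forall n, cmeasurable (m n)) -> (forall n x, modulus (m n x) <= 1) ->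
  (\forall x \ae mu, modulus (m n x) @[n --> \oo] --> (0 : R)) ->
  forall l : R, 0 < l ->
  \forall n \near \oo, (vnorm p (fun x => m n x * f x)%R <= l%:E)%E.
Proof.
move=> hp mf foo mm m1 mcv l l0.
pose D x := expo (modulus (f x) / l) (p x).
have mD : measurable_fun [set: euclidean R d] D by exact: measurable_modular.
have D0 x : (0 <= D x)%E by exact: expo_ge0.
have iD : mu.-integrable [set: euclidean R d] D.
  apply/integrableP; split => //.
  under eq_integral do rewrite gee0_abs//.
  exact: vnorm_finite_modular.
pose F n x := ((modulus (m n x))%:E * D x)%E.
have mF n : measurable_fun [set: euclidean R d] (F n).
  apply: (emeasurable_funM _ mD); apply/measurable_EFinP.
  exact: measurable_modulus.
have F0 n x : (0 <= F n x)%E by rewrite mule_ge0 ?lee_fin ?modulus_ge0.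
pose M : {measure set (euclidean R d) -> \bar R} := mu.
have Fcv0 : {ae M, forall x, setT x -> F ^~ x @ \oo --> cst 0%E x}.
  have Dfin := integrable_ae measurableT iD.
  apply: (ae_imply _ (ae_and mcv Dfin)) => x [mx /(_ I) Dx] _.
  rewrite /cst -(mul0e (D x)) /F /=.
  by apply: cvgeZr => //; apply: cvg_EFin mx; exact: nearW.
have FD : {ae M, forall x n, setT x -> (`|F n x| <= D x)%E}.
  apply: aeW => x n _; rewrite gee0_abs//.
  by rewrite /F -[leRHS]mul1e lee_wpmul2r// lee_fin.
have [_ _] := @dominated_convergence _ (euclidean R d) R M setT measurableT
  F (cst 0%E) D mF (measurable_cst _) Fcv0 iD FD.
rewrite integral0 => Fcv.
have : \forall n \near \oo, (\int[mu]_x F n x < 1)%E.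
  exact: (Fcv [set y | (y < 1)%E] (@open_ereal_lt' R 0%E 1%E lte01)).
apply: filterS => n Fn; apply: vnorm_le => //.
apply: le_trans (ltW Fn); apply: le_integral_lebesgue => //.
- exact: (measurable_modular hp l0 (cmeasurableM (mm n) mf)).
- by move=> x; exact: expo_ge0.
- apply: aeW => x; rewrite Normc.normcM -mulrA; apply: expo_contract.
  + by rewrite modulus_ge0 m1.
  + by rewrite divr_ge0 ?modulus_ge0 ?ltW.
  + by case: hp.
Qed.

End variable_lebesgue.

(** * Dominated convergence for sums *)

Section dominated_esum.
Set Implicit Arguments.
Unset Strict Implicit.
Context {R : realType} {T : choiceType}.
Local Open Scope ereal_scope.
Implicit Types (a : T -> \bar R) (b : nat -> T -> \bar R).

Lemma esumZ_le a (c : R) : (0 <= c)%R -> (forall k, 0 <= a k) ->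
  \esum_(k in [set: T]) (c%:E * a k) <= c%:E * \esum_(k in [set: T]) a k.
Proof.
move=> c0 a0; apply: ge_ereal_sup => _ [X [finX _] <-].
rewrite -ge0_mule_fsumr//; apply: lee_wpmul2l; first by rewrite lee_fin.
by apply: ereal_sup_ubound; exists X.
Qed.

Lemma sum_eventually_small b (s : seq T) :
  (forall k (e : R), (0 < e)%R -> \forall n \near \oo, b n k <= e%:E) ->
  forall e : R, (0 < e)%R ->
  \forall n \near \oo, \sum_(k <- s) b n k <= e%:E.
Proof.
move=> bcv; elim: s => [|x s IHs] e e0.
  by apply: nearW => n; rewrite big_nil lee_fin ltW.
have e20 : (0 < e / 2)%R by rewrite divr_gt0.
apply: filterS2 (bcv x _ e20) (IHs _ e20) => n bx bs.
by rewrite big_cons [e]splitr EFinD leeD.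
Qed.

(** Tannery's theorem: a finite set carries all but a small part of the
dominating sum, and finitely many terms are small together. *)
Lemma esum_eventually_small a b :
  (forall n k, 0 <= b n k <= a k) -> \esum_(k in [set: T]) a k < +oo ->
  (forall k (e : R), (0 < e)%R -> \forall n \near \oo, b n k <= e%:E) ->
  forall e : R, (0 < e)%R ->
  \forall n \near \oo, \esum_(k in [set: T]) b n k <= e%:E.
Proof.
move=> ba afin bcv e e0.
have b0 n k : 0 <= b n k by case/andP: (ba n k).
have a0 k : 0 <= a k by case/andP: (ba 0%N k) => b0k; exact: le_trans.
have e20 : (0 < e / 2)%R by rewrite divr_gt0.
have afn : \esum_(k in [set: T]) a k \is a fin_num.
  by rewrite ge0_fin_numE// esum_ge0.
have [_ [X [finX _] <-] Xa] := ub_ereal_sup_adherent e20 afn.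
have split_esum (f : T -> \bar R) : (forall k, 0 <= f k) -> \esum_(k in [set: T]) f k =
    \sum_(k \in X) f k + \esum_(k in ~` X) f k.
  by move=> f0; rewrite (@esumID _ _ X setT f) // !setTI esum_fset.
have tail : \esum_(k in ~` X) a k <= (e / 2)%:E.
  move: Xa afn; rewrite -/(esum [set: T] a) split_esum//.
  have := esum_ge0 (fun k (_ : (~` X) k) => a0 k).
  have : 0 <= \sum_(k \in X) a k by apply: fsume_ge0.
  move: (\sum_(k \in X) a k) (\esum_(k in ~` X) a k) => [x| |] [y| |]//=.
  by rewrite ?lee_fin ?lte_fin => x0 y0 xy _; lra.
have := sum_eventually_small (finmap.enum_fset (fset_set X)) bcv e20.
apply: filterS => n small; rewrite split_esum// [e]splitr EFinD leeD//.
  by rewrite fsbig_finite.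
by apply: le_trans tail; apply: le_esum => k _; case/andP: (ba n k).
Qed.

End dominated_esum.

(** * Amalgam spaces *)

Section amalgams.
Set Implicit Arguments.
Unset Strict Implicit.
Context {R : realType} {d : nat}.
Local Notation V := 'rV[R]_d.
Local Notation modulus := Normc.normc.
Local Notation mu := (@lebesgue R d).
Implicit Types (f g : V -> R[i]) (p : V -> \bar R) (q : R).

Lemma cutoffM (A : set V) (m f : V -> R[i]) :
  cutoff A (fun x => m x * f x) = (fun x => m x * cutoff A f x).
Proof.
by apply/funext => x; rewrite /cutoff /patch; case: ifP; rewrite ?mulr0.
Qed.

Lemma cmeasurable_cst (c : R[i]) : cmeasurable (fun _ : V => c).
Proof. by split; exact: measurable_cst. Qed.

Lemma vnormM_le p (m f : V -> R[i]) : variable_exponent p ->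
  cmeasurable m -> (forall x, modulus (m x) <= 1) -> cmeasurable f ->
  (vnorm p (fun x => m x * f x)%R <= vnorm p f)%E.
Proof.
move=> hp mm m1 mf; apply: (le_vnorm hp (cmeasurableM mm mf) mf).
apply: aeW => x; rewrite Normc.normcM -[leRHS]mul1r.
by rewrite ler_wpM2r ?modulus_ge0.
Qed.

Lemma Lvar_locM p (m f : V -> R[i]) : variable_exponent p ->
  cmeasurable m -> (forall x, modulus (m x) <= 1) -> Lvar_loc p f ->
  Lvar_loc p (fun x => m x * f x).
Proof.
move=> hp mm m1 [mf fK]; split; first exact: (cmeasurableM mm mf).
move=> K cK; have [mfK fKoo] := fK K cK.
rewrite cutoffM; split; first exact: (cmeasurableM mm mfK).
exact: le_lt_trans (vnormM_le hp mm m1 mfK) fKoo.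
Qed.

Lemma Lvar_locZ p (c : R[i]) f : c != 0 -> Lvar_loc p f ->
  Lvar_loc p (fun x => c * f x).
Proof.
move=> c0 [mf fK]; split; first exact: (cmeasurableM (cmeasurable_cst c) mf).
move=> K cK; have [mfK fKoo] := fK K cK; rewrite cutoffM; split.
  exact: (cmeasurableM (cmeasurable_cst c) mfK).
apply: le_lt_trans (vnormZ_le _ _ c0) _.
by rewrite lte_mul_pinfty ?lee_fin ?modulus_ge0.
Qed.

Lemma amalgam_norm_finite p q f : 1 <= q -> (amalgam_norm p q f < +oo)%E ->
  (\esum_(k in [set: 'rV[int]_d]) (vnorm p (cutoff (cube 1 k) f) `^ q) < +oo)%E.
Proof.
move=> q1; apply: lty_poweRy.
by rewrite invr_eq0 gt_eqF// (lt_le_trans ltr01).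
Qed.

Lemma poweR_le (x y : \bar R) q : 0 <= q -> (0 <= x)%E -> (x <= y)%E ->
  (x `^ q <= y `^ q)%E.
Proof.
move=> q0 x0 xy; apply: gt0_ler_poweR => //; rewrite in_itv/= ?leey ?andbT//.
exact: le_trans xy.
Qed.

Lemma amalgamM p q (m g : V -> R[i]) : variable_exponent p -> 1 <= q ->
  cmeasurable m -> (forall x, modulus (m x) <= 1) -> amalgam p q g ->
  amalgam p q (fun x => m x * g x) /\
  (amalgam_norm p q (fun x => m x * g x)%R <= amalgam_norm p q g)%E.
Proof.
move=> hp q1 mm m1 [gloc goo].
have q0 : 0 <= q by apply: le_trans q1.
have le_norm : (amalgam_norm p q (fun x => m x * g x)%R <= amalgam_norm p q g)%E.
  apply: poweR_le; first by rewrite invr_ge0.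
    by apply: esum_ge0 => k _; exact: poweR_ge0.
  apply: le_esum => k _; apply: poweR_le => //; first exact: vnorm_ge0.
  rewrite cutoffM; apply: (vnormM_le hp mm m1).
  exact: (cmeasurable_cutoff (measurable_cube _ _) gloc.1).
split; last exact: le_norm.
split; first exact: (Lvar_locM hp mm m1 gloc).
exact: le_lt_trans le_norm goo.
Qed.

Lemma amalgamZ p q (c : R[i]) g : 1 <= q -> c != 0 -> amalgam p q g ->
  amalgam p q (fun x => c * g x).
Proof.
move=> q1 c0 [gloc goo]; split; first exact: (Lvar_locZ c0 gloc).
apply: poweR_lty; have /(amalgam_norm_finite q1) goo' := goo.
have q0 : 0 <= q by apply: le_trans q1.
apply: (@le_lt_trans _ _ ((modulus c `^ q)%:E *
  \esum_(k in [set: 'rV[int]_d]) (vnorm p (cutoff (cube 1 k) g) `^ q))%E).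
  apply: le_trans (esumZ_le _ _); last 2 first.
  - exact: powR_ge0.
  - by move=> k; exact: poweR_ge0.
  apply: le_esum => k _.
  rewrite -poweR_EFin -poweRM ?lee_fin ?modulus_ge0 ?vnorm_ge0//.
  apply: poweR_le => //; first exact: vnorm_ge0.
  by rewrite cutoffM; exact: vnormZ_le.
by rewrite lte_mul_pinfty ?lee_fin ?powR_ge0.
Qed.

(** The sum over the cubes is handled by Tannery's theorem, each cube by the
absolute continuity of the variable Lebesgue norm. *)
Lemma amalgam_multiplier_cvg0 p q g (m : nat -> V -> R[i]) :
  variable_exponent p -> 1 <= q -> amalgam p q g ->
  (forall n, cmeasurable (m n)) -> (forall n x, modulus (m n x) <= 1) ->
  (\forall x \ae mu, modulus (m n x) @[n --> \oo] --> (0 : R)) ->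
  \forall n \near \oo, (amalgam_norm p q (fun x => m n x * g x)%R <= 1)%E.
Proof.
move=> hp q1 [gloc /(amalgam_norm_finite q1) goo] mm m1 mcv.
have q0 : 0 < q by apply: lt_le_trans q1.
have mcut k : cmeasurable (cutoff (cube 1 k) g).
  exact: (cmeasurable_cutoff (measurable_cube _ _) gloc.1).
pose b n k := (vnorm p (cutoff (cube 1 k) (fun x => m n x * g x)%R) `^ q)%E.
have : \forall n \near \oo, (\esum_(k in [set: 'rV[int]_d]) b n k <= 1%:E)%E.
  apply: (esum_eventually_small _ goo _ ltr01).
  - move=> n k; rewrite poweR_ge0/=; apply: poweR_le; rewrite ?(ltW q0)//.
      exact: vnorm_ge0.
    by rewrite cutoffM; exact: (vnormM_le hp (mm n) (m1 n) (mcut k)).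
  - move=> k e e0.
    have koo : (vnorm p (cutoff (cube 1 k) g) < +oo)%E.
      apply: (@lty_poweRy _ _ q); first by rewrite gt_eqF.
      apply: le_lt_trans goo; apply: esum_ge; exists [set k].
        by split => //; exact: finite_set1.
      by rewrite fsbig_set1.
    pose l := Num.min 1 e.
    have l0 : 0 < l by rewrite lt_min ltr01.
    have := vnorm_multiplier_cvg0 hp (mcut k) koo mm m1 mcv l0.
    apply: filterS => n small; rewrite /b cutoffM.
    apply: le_trans (poweR_le (ltW q0) (vnorm_ge0 _ _) small) _.
    rewrite poweR_EFin lee_fin (@le_trans _ _ l)//.
      by apply: ge1r_powR => //; rewrite l0 ge_min lexx.
    by rewrite ge_min lexx orbT.
apply: filterS => n small; rewrite -(@poweR1r R q^-1).
apply: poweR_le => //; first by rewrite invr_ge0 ltW.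
by apply: esum_ge0 => k _; exact: poweR_ge0.
Qed.

End amalgams.

(** * Multipliers on decompositions *)

Section multipliers.
Set Implicit Arguments.
Unset Strict Implicit.
Local Open Scope complex_scope.
Context {R : realType} {d : nat}.
Local Notation V := 'rV[R]_d.
Local Notation modulus := Normc.normc.
Local Notation mu := (@lebesgue R d).
Implicit Types (f h g : V -> R[i]) (p : V -> \bar R) (q : R).

Lemma Lvar_loc_norm p f : variable_exponent p -> Lvar_loc p f ->
  Lvar_loc p (fun x => `|f x|).
Proof.
have norm_meas g : cmeasurable g -> cmeasurable (fun x => `|g x|).
  move=> mg; rewrite (_ : (fun x => _) = (fun x => (modulus (g x))%:C)).
    exact: (cmeasurable_real (measurable_modulus mg)).
  by apply/funext => x; rewrite normc_modulus.
move=> hp [mf fK]; split; first exact: norm_meas mf.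
move=> K cK; have [mfK fKoo] := fK K cK.
have -> : cutoff K (fun x => `|f x|) = (fun x => `|cutoff K f x|).
  by apply/funext => x; rewrite /cutoff /patch; case: ifP; rewrite ?normr0.
split; first exact: norm_meas mfK.
apply: le_lt_trans fKoo; apply: (le_vnorm hp (norm_meas _ mfK) mfK).
by apply: aeW => x; rewrite normc_modulus modulus_real ger0_norm ?modulus_ge0.
Qed.

Lemma coef_sum_ge0 (c : nat -> R[i]) : (0 <= Defs.coef_sum c)%E.
Proof. by apply: nneseries_ge0 => k *; rewrite lee_fin modulus_ge0. Qed.

Lemma cutoffB (A : set V) f g :
  cutoff A (fun x => f x - g x) = (fun x => cutoff A f x - cutoff A g x).
Proof.
by apply/funext => x; rewrite /cutoff /patch; case: ifP; rewrite ?subr0.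
Qed.

(** A multiplier bounded by 1 acts on decompositions: since dilation is a change
of variable, multiplying the sum by [m] amounts to multiplying the [k]-th atom
by [m] dilated by [rho k]. The factors [t k] transfer mass between the
coefficients and the atoms. *)
Lemma h_decomposition_multiplier p q alpha f h c rho (g : nat -> V -> R[i]) (m : V -> R[i])
    (t : nat -> R) : variable_exponent p -> 1 <= q ->
  h_decomposition p q alpha f c rho g ->
  cmeasurable m -> (forall x, modulus (m x) <= 1) -> (forall k, 0 < t k) ->
  (forall k, (amalgam_norm p q
    (fun x => m (rho k *: x) * ((t k)^-1%:C * g k x))%R <= 1)%E) ->
  (Defs.coef_sum (fun k => (t k)%:C * c k)%R < +oo)%E ->
  Lvar_loc p h -> (\forall x \ae mu, m x * f x = h x) ->
  h_decomposition p q alpha h (fun k => (t k)%:C * c k) rho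
    (fun k x => m (rho k *: x) * ((t k)^-1%:C * g k x)).
Proof.
move=> hp q1 [rho0 gA _ [SL fL Scv]] mm m1 t0 g1 coo hL mfh.
have SE N : (fun x => \sum_(k < N) (t k)%:C * c k *
      dil alpha (rho k) (fun x => m (rho k *: x) * ((t k)^-1%:C * g k x)) x)
    = (fun x => m x * \sum_(k < N) c k * dil alpha (rho k) (g k) x).
  apply/funext => x; rewrite mulr_sumr; apply: eq_bigr => k _.
  rewrite /dil scalerA divff ?gt_eqF// scale1r.
  have tC : (t k)%:C * (t k)^-1%:C = 1 :> R[i].
    by rewrite -rmorphM divff ?gt_eqF.
  set a := (t k)%:C in tC *; set b := (t k)^-1%:C in tC *.
  set y := g k _; set r := (_ `^ _)%:C.
  transitivity ((a * b) * (m x * (c k * (r * y)))); first by ring.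
  by rewrite tC mul1r.
split; [exact: rho0| |exact: coo|].
  move=> k; split; last exact: g1.
  have tV0 : (t k)^-1%:C != 0 :> R[i].
    by rewrite fmorph_eq0 invr_eq0 gt_eqF.
  apply: (amalgamM hp q1 (cmeasurable_scale (rho0 k) mm) (fun x => m1 _) _).1.
  exact: (amalgamZ q1 tV0 (gA k).1).
split; [|exact: hL|].
  by move=> N; rewrite SE; exact: (Lvar_locM hp mm m1 (SL N)).
move=> K cK; have Kcv := Scv K cK.
apply: (squeeze_cvge _ (cvg_cst _) Kcv); apply: nearW => N.
rewrite vnorm_ge0/= !cutoffB SE.
have [mS _] := (SL N).2 K cK; have [mf _] := fL.2 K cK.
have [mh _] := hL.2 K cK.
set S := (fun x => \sum_(k < N) _ : R[i]) in mS *.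
rewrite (cutoffM K m S).
apply: (le_vnorm hp (cmeasurableB (cmeasurableM mm mS) mh) (cmeasurableB mS mf)).
apply: ae_imply mfh => x mfh.
rewrite (_ : _ - _ = m x * (cutoff K S x - cutoff K f x)); last first.
  by rewrite mulrBr; congr (_ - _); rewrite /cutoff /patch; case: ifP;
    rewrite ?mulr0 ?mfh.
by rewrite Normc.normcM -[leRHS]mul1r ler_wpM2r ?modulus_ge0.
Qed.

Lemma near_forall_lt (P : nat -> nat -> Prop) N :
  (forall k, \forall n \near \oo, P k n) ->
  \forall n \near \oo, forall k, (k < N)%N -> P k n.
Proof.
move=> Pcv; elim: N => [|N IHN]; first exact: nearW.
apply: filterS2 (Pcv N) IHN => n PN Plt k.
by rewrite ltnS leq_eqVlt => /predU1P[->//|]; exact: Plt.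
Qed.

(** After a finite number [N] of terms the coefficients add up to at most
[e / 2]. In the first [N] terms the coefficients are shrunk so that they also
add up to at most [e / 2], and the atoms grow by a fixed factor; this growth is
eventually absorbed by the multipliers. *)
Lemma sigma_multiplier_cvg0 p q alpha f (h m : nat -> V -> R[i]) :
  variable_exponent p -> 1 <= q -> Hspace p q alpha f ->
  (forall n, cmeasurable (m n)) -> (forall n x, modulus (m n x) <= 1) ->
  (\forall x \ae mu, modulus (m n x) @[n --> \oo] --> (0 : R)) ->
  (forall n, Lvar_loc p (h n)) ->
  (forall n, \forall x \ae mu, m n x * f x = h n x) ->
  forall e : R, 0 < e -> \forall n \near \oo, (sigma p q alpha (h n) <= e%:E)%E.
Proof.
move=> hp q1 [_ [c [rho [g fdec]]]] mm m1 mcv hL mfh e e0.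
have [rho0 gA coo _] := fdec.
have c0 k : (0 <= (modulus (c k))%:E)%E by rewrite lee_fin modulus_ge0.
have e20 : 0 < e / 2 by rewrite divr_gt0.
have [N tailN] : exists N, (\sum_(N <= k <oo) (modulus (c k))%:E <= (e / 2)%:E)%E.
  have eE0 : (0 < (e / 2)%:E)%E by rewrite lte_fin.
  have tail0 := nneseries_tail_cvg coo (fun k _ => c0 k).
  have [N _ tailN] := tail0 [set y | (y < (e / 2)%:E)%E]
    (@open_ereal_lt' R 0%E _ eE0).
  by exists N; apply: ltW; exact: (tailN N (leqnn N)).
have cfin : Defs.coef_sum c \is a fin_num by rewrite ge0_fin_numE ?coef_sum_ge0.
pose C := fine (Defs.coef_sum c).
have C0 : 0 <= C by rewrite fine_ge0 ?coef_sum_ge0.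
(* The [+ 1] covers the case of zero coefficients. *)
pose s := e / 2 / (C + 1).
have C1 : 0 < C + 1 by rewrite ltr_wpDl.
have s0 : 0 < s by rewrite divr_gt0.
pose t k := if (k < N)%N then s else 1.
have t0 k : 0 < t k by rewrite /t; case: ifP.
have sum_t : (Defs.coef_sum (fun k => ((t k)%:C * c k)%R) <= e%:E)%E.
  rewrite [e]splitr EFinD /Defs.coef_sum (nneseries_split 0%N N); last first.
    by move=> k _; rewrite lee_fin modulus_ge0.
  rewrite add0n; apply: leeD; last first.
    apply: le_trans tailN; rewrite le_eqVlt; apply/orP; left; apply/eqP.
    apply: congr_lim; apply/funext => n /=; apply: eq_big_nat => k /andP[Nk _].
    by rewrite /t ltnNge Nk/= mul1r.
  apply: (@le_trans _ _ (s%:E * Defs.coef_sum c)%E); last first.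
    rewrite -(fineK cfin) -EFinM lee_fin -/C /s mulrAC ler_pdivrMr//.
    by rewrite ler_wpM2l ?ltW// ltrDl.
  rewrite /Defs.coef_sum (nneseries_split 0%N N)// add0n.
  apply: (@le_trans _ _ (s%:E * \sum_(0 <= k < N) (modulus (c k))%:E)%E).
    rewrite ge0_sume_distrr// le_eqVlt; apply/orP; left; apply/eqP.
    apply: eq_big_nat => k /andP[_ kN].
    by rewrite /t kN Normc.normcM modulus_real gtr0_norm// EFinM.
  apply: lee_wpmul2l; first by rewrite lee_fin ltW.
  by rewrite leeDl// nneseries_ge0.
have atoms k : \forall n \near \oo, (amalgam_norm p q
    (fun x => m n (rho k *: x) * (s^-1%:C * g k x))%R <= 1)%E.
  have sV0 : s^-1%:C != 0 :> R[i] by rewrite fmorph_eq0 invr_eq0 gt_eqF.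
  apply: (amalgam_multiplier_cvg0 hp q1 (amalgamZ q1 sV0 (gA k).1)).
  - by move=> n; exact: (cmeasurable_scale (rho0 k) (mm n)).
  - by move=> n x; exact: m1.
  - exact: (ae_scale (rho0 k) mcv).
have := near_forall_lt N atoms; apply: filterS => n atomsN.
apply: (le_trans _ sum_t); apply: ereal_inf_lbound.
exists (fun k => (t k)%:C * c k), rho,
  (fun k x => m n (rho k *: x) * ((t k)^-1%:C * g k x)); split; last by [].
apply: (h_decomposition_multiplier hp q1 fdec (mm n) (m1 n) t0 _ _ (hL n) (mfh n)).
- move=> k; rewrite /t; case: ifP => [kN|_]; first exact: atomsN.
  have -> : (fun x => m n (rho k *: x) * ((1^-1 : R)%:C * g k x))
      = (fun x => m n (rho k *: x) * g k x).
    by apply/funext => x; rewrite invr1 mul1r.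
  apply: le_trans (gA k).2.
  exact: (amalgamM hp q1 (cmeasurable_scale (rho0 k) (mm n))
    (fun x => m1 n _) (gA k).1).2.
- exact: le_lt_trans sum_t (ltey _).
Qed.

(** Decreasing to 0 forces the terms to be nonnegative reals. *)
Lemma modulus_decreasing_le (z : nat -> R[i]) (w : R[i]) :
  (forall n, z n <= `|w| /\ z n.+1 <= z n) ->
  modulus (z n) @[n --> \oo] --> (0 : R) ->
  forall n, modulus (z n) <= modulus w.
Proof.
move=> zw zcv n.
have zE k : z k = (complex.Re (z k))%:C.
  have [+ _] := zw k; rewrite normc_modulus lecE => /andP[/eqP/= + _].
  by case: (z k) => a b /= <-.
have modE k : modulus (z k) = `|complex.Re (z k)|.
  by rewrite {1}zE modulus_real.
have Re_le k : complex.Re (z k) <= modulus w.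
  by have [+ _] := zw k; rewrite normc_modulus lecE => /andP[_ +].
have Re_decr j k : (j <= k)%N -> complex.Re (z k) <= complex.Re (z j).
  elim: k => [|k IHk]; first by rewrite leqn0 => /eqP->.
  rewrite leq_eqVlt => /predU1P[->//|]; rewrite ltnS => /IHk; apply: le_trans.
  by have [_ +] := zw k; rewrite lecE => /andP[_ +].
rewrite modE ger0_norm//; rewrite leNgt; apply/negP => zn0.
have nz0 : 0 < - complex.Re (z n) by rewrite oppr_gt0.
have /cvgrPdist_lt /(_ _ nz0) [M _ zM] := zcv.
have := zM (maxn M n) (leq_maxl _ _).
rewrite /= sub0r normrN modE normr_id => small.
have := Re_decr n (maxn M n) (leq_maxr _ _) => le_n.
have := ler_norm (- complex.Re (z (maxn M n))); rewrite normrN => ge_n.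
have := le_lt_trans ge_n small; rewrite ltrN2 => lt_n.
by have := lt_le_trans lt_n le_n; rewrite ltxx.
Qed.

Lemma cvge_squeeze0 (x : nat -> \bar R) : (forall n, 0 <= x n)%E ->
  (forall e : R, 0 < e -> \forall n \near \oo, (x n <= e%:E)%E) ->
  x n @[n --> \oo] --> 0%E.
Proof.
move=> x0 xe; apply: cvg_EFin.
  apply: filterS (xe 1 ltr01) => n x1; rewrite ge0_fin_numE//.
  exact: le_lt_trans x1 (ltey _).
apply/cvgrPdist_le => e e0; apply: filterS (xe e e0) => n xne.
have xfin : x n \is a fin_num.
  by rewrite ge0_fin_numE//; exact: le_lt_trans xne (ltey _).
rewrite sub0r normrN /= ger0_norm ?fine_ge0//.
by rewrite -lee_fin fineK.
Qed.

(** The multiplier that turns [f] into [|u|] wherever [|u| <= |f|]. The minimum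
keeps its modulus at most 1 also off that set, and since inversion maps 0 to 0
it vanishes with [f]. *)
Definition phase_quotient (u f : V -> R[i]) : V -> R[i] :=
  fun x => (Num.min (modulus (u x)) (modulus (f x)))%:C * (f x)^-1.

Lemma cmeasurable_phase_quotient u f : cmeasurable u -> cmeasurable f ->
  cmeasurable (phase_quotient u f).
Proof.
move=> mu' mf; apply: (cmeasurableM _ (cmeasurableV mf)).
apply: cmeasurable_real.
exact: (measurable_minr (measurable_modulus mu') (measurable_modulus mf)).
Qed.

Lemma modulus_phase_quotient u f x : modulus (phase_quotient u f x) =
  Num.min (modulus (u x)) (modulus (f x)) / modulus (f x).
Proof.
rewrite Normc.normcM Normc.normcV modulus_real ger0_norm//.
by rewrite le_min !modulus_ge0.
Qed.

Lemma modulus_phase_quotient_le1 u f x : modulus (phase_quotient u f x) <= 1.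
Proof.
rewrite modulus_phase_quotient; have := modulus_ge0 (f x).
rewrite le_eqVlt => /predU1P[<-|f0]; first by rewrite invr0 mulr0 ler01.
by rewrite ler_pdivrMr// mul1r ge_min lexx orbT.
Qed.

Lemma phase_quotient_mul u f x : modulus (u x) <= modulus (f x) ->
  phase_quotient u f x * f x = `|u x|.
Proof.
move=> uf; rewrite /phase_quotient min_l// normc_modulus.
have [f0|f0] := eqVneq (f x) 0; last by rewrite mulfVK.
move: uf; rewrite f0 Normc.normc0 => uf.
by rewrite invr0 !mulr0; congr (_%:C); apply/eqP; rewrite eq_le uf modulus_ge0.
Qed.

Lemma phase_quotient_cvg0 (u : nat -> V -> R[i]) f x :
  modulus (u n x) @[n --> \oo] --> (0 : R) ->
  modulus (phase_quotient (u n) f x) @[n --> \oo] --> (0 : R).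
Proof.
move=> ucv.
have bound : modulus (u n x) / modulus (f x) @[n --> \oo] --> (0 : R).
  by rewrite -(mul0r (modulus (f x))^-1); apply: cvgMl.
apply: (squeeze_cvgr _ (cvg_cst _) bound); apply: nearW => n.
rewrite modulus_ge0/= modulus_phase_quotient ler_wpM2r ?invr_ge0 ?modulus_ge0//.
by rewrite ge_min lexx.
Qed.

End multipliers.

(** * Absolute continuity of the norm *)

Theorem theorem4p11 (R : realType) (d : nat) (hd : (0 < d)%N)
  (p : 'rV[R]_d -> \bar R) (hp : variable_exponent p)
  (q alpha : R) (hq : 1 <= q) (hqa : q <= alpha)
  (hap : \forall x \ae (@lebesgue R d), (alpha%:E <= p x)%E) :
  forall f : 'rV[R]_d -> R[i],
    Hspace p q alpha f -> Habs_continuous_norm p q alpha f.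
Proof.
move=> f fH u uH udecr ucv.
have uf : \forall x \ae (@lebesgue R d),
    forall n, Normc.normc (u n x) <= Normc.normc (f x).
  apply: ae_imply (ae_and (ae_forall udecr) ucv) => x [xdecr xcv].
  exact: modulus_decreasing_le xdecr xcv.
apply: cvge_squeeze0.
  move=> n; apply: le_ereal_inf_tmp => _ [c [rho [g [_ ->]]]].
  exact: coef_sum_ge0.
apply: (sigma_multiplier_cvg0 (m := fun n => phase_quotient (u n) f) hp hq fH).
- move=> n; exact: (cmeasurable_phase_quotient (uH n).1.1 fH.1.1).
- by move=> n x; exact: modulus_phase_quotient_le1.
- by apply: ae_imply ucv => x; exact: phase_quotient_cvg0.
- by move=> n; exact: (Lvar_loc_norm hp (uH n).1).
- by move=> n; apply: ae_imply uf => x ufx; exact: phase_quotient_mul.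
Qed.
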